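(* Let $\mathcal{G}=(\mathcal{V},\mathcal{E})$ be a finite, simple, connected, undirected graph and let $v\in\mathcal{V}$. Let $\mathcal{G}_v$ be the subgraph of $\mathcal{G}$ obtained by keeping $v$ and all its neighbours and deleting every other vertex together with its edges (i.e. the subgraph induced on $v$ and its neighbours, which is a cone with apex $v$). Then there exists a swift chiral quantum walk of the adjacency type starting from $v$ in $\mathcal{G}$ if and only if both of the following conditions hold: (a) there is a swift chiral quantum walk of the adjacency type starting from $v$ in $\mathcal{G}_v$; (b) any vertex $v'\neq v$ of $\mathcal{G}$ which is not a neighbour of $v$ has either $0$ or at least $2$ common neighbours with $v$.
   Context: Let $\mathcal{G}$ be a finite simple undirected graph with $n$ vertices and adjacency matrix $\mathbf{A}$. A chiral adjacency matrix on $\mathcal{G}$ is an $n\times n$ hermitian matrix $\tilde{\mathbf{A}}$ such that $\tilde{\mathbf{A}}_{jk}$ is a complex number of modulus $1$ whenever $\mathbf{A}_{jk}=1$, and $\tilde{\mathbf{A}}_{jk}=0$ whenever $\mathbf{A}_{jk}=0$ (in particular the diagonal is zero). For a vertex $v$, $\underline{e}_v\in\mathbb{C}^n$ denotes the standard basis vector corresponding to $v$. There exists a swift chiral quantum walk of the adjacency type starting from $v$ in $\mathcal{G}$ if there is a chiral adjacency matrix $\tilde{\mathbf{A}}$ on $\mathcal{G}$ such that $|\underline{e}_v^\dagger e^{-i\tilde{\mathbf{A}}t}\underline{e}_v|^2=\cos^2(\sqrt{d}\,t)$ for all $t\ge 0$, where $d$ is the degree (number of neighbours) of $v$ in $\mathcal{G}$.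 The same definition applies with $\mathcal{G}_v$ in place of $\mathcal{G}$ (the degree of $v$ is the same in both graphs). *)

(* Defs.v *)
From HB Require Import structures.
From mathcomp Require Import all_boot all_order all_algebra.
From mathcomp Require Import sesquilinear spectral complex.
From mathcomp Require Import all_classical all_reals all_analysis.

Set Implicit Arguments.
Unset Strict Implicit.
Unset Printing Implicit Defensive.

Import Order.TTheory GRing.Theory Num.Theory.
Import numFieldNormedType.Exports.
Local Open Scope classical_set_scope.
Local Open Scope ring_scope.
Local Open Scope sesquilinear_scope.

(* The limit is taken for the topology of matrices induced by the norm of K. *)
Definition expmx (K : numFieldType) (n : nat) (M : 'M[K]_n) : 'M[K]_n :=
  lim (series (fun k : nat => (k`!%:R)^-1 *: M ^+ k) @ \oo).

(* A finite simple undirected graph is a symmetric irreflexive relation [e] on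
   a finite type [T]; matrices indexed by [T] are matrices of size #|T|, whose
   indices are identified with vertices through [enum_rank]/[enum_val]. *)

Definition nbrs (T : finType) (e : rel T) (v : T) : {set T} :=
  [set w | e v w].

Definition degree (T : finType) (e : rel T) (v : T) : nat := #|nbrs e v|.

Definition connected_graph (T : finType) (e : rel T) : Prop :=
  forall x y : T, connect e x y.

Definition closed_nbrs (T : finType) (e : rel T) (v : T) : {set T} :=
  v |: nbrs e v.

Definition induced (T : finType) (e : rel T) (S : {set T}) :
    rel {x : T | x \in S} :=
  fun x y => e (val x) (val y).

Definition cone (T : finType) (e : rel T) (v : T) :
    rel {x : T | x \in closed_nbrs e v} :=
  @induced T e (closed_nbrs e v).
Arguments cone {T} e v.

Definition apex (T : finType) (e : rel T) (v : T) :
    {x : T | x \in closed_nbrs e v} :=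
  exist _ v (setU11 v (nbrs e v)).

Definition adjmx (K : pzSemiRingType) (T : finType) (e : rel T) :
    'M[K]_#|T| :=
  \matrix_(j, k) (e (enum_val j) (enum_val k))%:R.

Definition chiral_adjmx (R : realType) (T : finType) (e : rel T)
    (A : 'M[R[i]]_#|T|) : Prop :=
  [/\ A \is hermsymmx,
      forall j k, adjmx R[i] e j k = 1 -> `|A j k| = 1 &
      forall j k, adjmx R[i] e j k = 0 -> A j k = 0].

Definition ket (R : realType) (T : finType) (v : T) : 'cV[R[i]]_#|T| :=
  delta_mx (enum_rank v) 0.

(* The amplitude is the single entry of a 1 x 1 matrix; its modulus lives in
   R[i], hence the embedding of the real right-hand side. *)
Definition swift_walk (R : realType) (T : finType) (e : rel T) (v : T) :
    Prop :=
  exists A : 'M[R[i]]_#|T|, chiral_adjmx e A /\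
    forall t : R, 0 <= t ->
      `|((ket R v) ^t* *m expmx ((- 'i%C * t%:C%C) *: A) *m ket R v) 0 0| ^+ 2
      = ((cos (Num.sqrt (degree e v)%:R * t)) ^+ 2)%:C%C.

(* Main.v *)
Require Import Defs.
From mathcomp Require Import all_boot all_order all_algebra.
From mathcomp Require Import sesquilinear spectral complex.
From mathcomp Require Import all_classical all_reals all_analysis.
From mathcomp Require Import ring.

(* For a chiral adjacency matrix A, write f(t) for the return amplitude at v.
   Since <v|A|v> = 0 and <v|A^2|v> = d, the coefficients of t^4 in |f(t)|^2 and
   in cos^2(sqrt d t) agree iff <v|A^4|v> = d^2, that is, iff
   |A^2 e_v|^2 = |<v|A^2 e_v>|^2: the equality case of Cauchy-Schwarz, so
   A^2 e_v = d e_v. Conversely that eigenvalue equation makes the exponential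
   series of f the cosine series. The walk is thus swift iff
   sum_u A_wu A_uv = 0 for every w <> v. For w in the cone this only involves
   entries of the cone; for w outside, it is a relation on the edges from w to
   its common neighbours with v, where each term has modulus 1 and a free phase,
   so it can be satisfied iff the number of terms is not 1 (take the powers of a
   root of 1 + X + ... + X^(m-1)). *)

Set Implicit Arguments.
Unset Strict Implicit.
Unset Printing Implicit Defensive.

Import Order.TTheory GRing.Theory Num.Theory.
Import numFieldNormedType.Exports.
Local Open Scope classical_set_scope.
Local Open Scope ring_scope.
Local Open Scope sesquilinear_scope.

Local Notation Re := (@complex.Re _).
Local Notation Im := (@complex.Im _).

(** * Limits in [R[i]] and entries of the matrix exponential *)

Lemma cvg_mx (K : numFieldType) (m n : nat) (T : Type) (F : set_system T)
    {FF : Filter F} (f : T -> 'M[K]_(m, n)) (L : 'M[K]_(m, n)) :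
  (forall i j, f x i j @[x --> F] --> L i j) -> f @ F --> L.
Proof.
move=> fL A [P LP PA]; rewrite nbhs_simpl.
suff : \forall x \near F, forall i j, P i j (f x i j).
  by apply: filterS => x /PA.
apply: filter_forall => i; apply: filter_forall => j; exact: fL (LP i j).
Qed.

Section complex_limits.
Variable R : realType.
Implicit Types (z : R[i]).

Lemma normc_real (x : R) : `|x%:C%C| = `|x|%:C%C.
Proof. by rewrite normc_def /= expr0n addr0 sqrtr_sqr. Qed.

Lemma normc_le_ReIm z : `|z| <= (`|Re z| + `|Im z|)%:C%C.
Proof.
rewrite {1}[z]complexE; apply: le_trans (ler_normD _ _) _.
rewrite normrM !normc_real rmorphD/= normc_def/=.
by rewrite expr0n expr1n add0r sqrtr1 mul1r.
Qed.

Lemma normc_ge_Im z : `|Im z|%:C%C <= `|z|.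
Proof.
by rewrite normc_def lecR -sqrtr_sqr ler_wsqrtr// lerDr sqr_ge0.
Qed.

Lemma cvg_complex (T : Type) (F : set_system T) {FF : Filter F}
    (u : T -> (R[i] : numFieldType)) (z : (R[i] : numFieldType)) :
  Re (u x) @[x --> F] --> Re z -> Im (u x) @[x --> F] --> Im z ->
  u x @[x --> F] --> z.
Proof.
move=> /cvgrPdist_lt uRe /cvgrPdist_lt uIm; apply/cvgrPdist_lt => eps eps0.
(* The order of [R[i]] only compares numbers with equal imaginary parts, so a positive [eps] is
   real. *)
have [e e0 ->] : exists2 e : R, 0 < e & eps = e%:C%C.
  by case: eps eps0 => a b; rewrite ltcE/= => /andP[/eqP-> a0]; exists a.
have e20 : 0 < e / 2 by rewrite divr_gt0.
near=> x.
apply: le_lt_trans (normc_le_ReIm _) _; rewrite ltcR (splitr e) ltrD//.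
  by rewrite raddfB/=; near: x; exact: uRe.
by rewrite raddfB/=; near: x; exact: uIm.
Unshelve. all: by end_near. Qed.

(** Passing to real and imaginary parts allows the comparison test for real series, here against the
    exponential series. *)
Lemma is_cvg_series_Re_Im (c : nat -> R[i]) (b : R) :
  (forall k, `|c k| <= (exp_coeff b k)%:C%C) ->
  cvgn (series (Re \o c)) /\ cvgn (series (Im \o c)).
Proof.
move=> cb.
have b0 k : 0 <= exp_coeff b k.
  by rewrite -ler0c; exact: le_trans (cb k).
by split; apply: normed_cvg;
  apply: (series_le_cvg _ b0 _ (is_cvg_series_exp_coeff b)) => k //=;
  rewrite -lecR; [apply: le_trans (normc_ge_Re _) _|
    apply: le_trans (normc_ge_Im _) _].
Qed.

End complex_limits.

Section expmx_entries.
Variables (R : realType) (n : nat).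
Implicit Types M : 'M[R[i]]_n.

Definition mx_sum_norm M : R := Re (\sum_i \sum_j `|M i j|).

Lemma mx_sum_normE M : (mx_sum_norm M)%:C%C = \sum_i \sum_j `|M i j|.
Proof.
apply: RRe_real; apply: ger0_real.
by apply: sumr_ge0 => i _; apply: sumr_ge0.
Qed.

(** Induction on [k]: the sum of the moduli in row [i] is at most the sum over the whole matrix. *)
Lemma norm_expr_mx_le M k i j :
  `|(M ^+ k) i j| <= (mx_sum_norm M ^+ k)%:C%C.
Proof.
elim: k i j => [|k IH] i j.
  by rewrite !expr0 mxE rmorph1; case: (i == j); rewrite ?normr1 ?normr0.
rewrite exprS mxE; apply: le_trans (ler_norm_sum _ _ _) _.
apply: (@le_trans _ _ ((\sum_l `|M i l|) * (mx_sum_norm M ^+ k)%:C%C)).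
  rewrite mulr_suml; apply: ler_sum => l _; rewrite normrM.
  by apply: ler_wpM2l.
rewrite exprS rmorphM/= ler_wpM2r//.
  by apply: le_trans (IH i j); exact: normr_ge0.
rewrite mx_sum_normE [leRHS](bigD1 i)//= lerDl.
by apply: sumr_ge0 => l _; exact: sumr_ge0.
Qed.

(** [expmx] is a [lim], so convergence has to be established first. The series of each entry is
    dominated by the exponential series of [mx_sum_norm M]; the matrix of the entrywise sums is then
    the limit, by uniqueness. *)
Lemma expmx_entry_cvg M i j :
  series (fun k => Re ((k`!%:R)^-1 * (M ^+ k) i j)) @ \oo
    --> Re (expmx M i j) /\
  series (fun k => Im ((k`!%:R)^-1 * (M ^+ k) i j)) @ \oo
    --> Im (expmx M i j).
Proof.
pose d i j k := (k`!%:R)^-1 * (M ^+ k) i j.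
have cv i' j' := @is_cvg_series_Re_Im R (d i' j') (mx_sum_norm M).
have {}cv i' j' :
    cvgn (series (Re \o d i' j')) /\ cvgn (series (Im \o d i' j')).
  apply: cv => k; rewrite /d normrM /exp_coeff/= mulrC rmorphM/=.
  rewrite ler_pM//; first exact: norm_expr_mx_le.
  by rewrite normfV normr_nat fmorphV/= rmorph_nat.
pose L := \matrix_(i, j) Complex (limn (series (Re \o d i j)))
    (limn (series (Im \o d i j))).
suff -> : expmx M = L by rewrite !mxE; exact: cv.
apply: cvg_lim; first exact: norm_hausdorff.
apply: cvg_mx => i' j'; rewrite mxE.
have [cvR cvI] := cv i' j'.
apply: cvg_complex; rewrite /=.
  apply: cvg_trans cvR; apply: near_eq_cvg; near=> N.
  rewrite !seriesEnat/= summxE raddf_sum.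
  by apply: eq_bigr => k _; rewrite /= mxE.
apply: cvg_trans cvI; apply: near_eq_cvg; near=> N.
rewrite !seriesEnat/= summxE raddf_sum.
by apply: eq_bigr => k _; rewrite /= mxE.
Unshelve. all: by end_near. Qed.

End expmx_entries.

(** * Fourth order expansions *)

Section taylor.
Variable R : realType.

(** On [0, 1] one has t^k <= t^m for k >= m, so the tail from rank [m] on is at most t^m times the
    whole exponential series of [b]. *)
Lemma series_taylor_tail (a : nat -> R) (b t l : R) (m : nat) :
  (forall k, `|a k| <= exp_coeff b k) -> 0 <= t <= 1 ->
  series (fun k => a k * t ^+ k) @ \oo --> l ->
  `|l - \sum_(k < m) a k * t ^+ k| <= expR b * t ^+ m.
Proof.
move=> ab /andP[t0 t1] al.
have b0 k : 0 <= exp_coeff b k by exact: le_trans (ab k).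
have sb N : series (exp_coeff b) N <= expR b.
  apply: nondecreasing_cvgn_le (is_cvg_series_exp_coeff b) N.
  exact: nondecreasing_series.
have cvl : `|series (fun k => a k * t ^+ k) N - \sum_(k < m) a k * t ^+ k|
    @[N --> \oo] --> `|l - \sum_(k < m) a k * t ^+ k|.
  by apply: cvg_norm; apply: cvgB => //; exact: cvg_cst.
rewrite -(cvg_lim (@Rhausdorff R) cvl).
apply: limr_le; first by apply/cvg_ex; eexists; exact: cvl.
near=> N.
have mN : (m <= N)%N by near: N; exact: nbhs_infty_ge.
rewrite seriesEnat/= (big_cat_nat (n := m))//= big_mkord addrAC subrr add0r.
apply: le_trans (ler_norm_sum _ _ _) _.
apply: (@le_trans _ _ (\sum_(m <= k < N) exp_coeff b k * t ^+ m)); last first.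
  rewrite -mulr_suml ler_wpM2r ?exprn_ge0//; apply: le_trans (sb N).
  rewrite seriesEnat/= [leRHS](big_cat_nat (n := m))//= lerDr.
  by apply: sumr_ge0.
rewrite !big_nat; apply: ler_sum => k /andP[mk _].
rewrite normrM ler_pM// normrX (ger0_norm t0).
by apply: ler_wiXn2l.
Unshelve. all: by end_near. Qed.

(** This plays the role of O(1) as t tends to 0. Closure under the ring operations lets the bound of
    a polynomial expression in remainders be found from its syntax alone. *)
Definition bounded01 (f : R -> R) :=
  exists B, forall t, 0 <= t <= 1 -> `|f t| <= B.

Lemma bounded01_cst c : bounded01 (fun=> c).
Proof. by exists `|c|. Qed.

Lemma bounded01_id : bounded01 id.
Proof. by exists 1 => t /andP[t0 t1]; rewrite ger0_norm. Qed.

Lemma bounded01D f g :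
  bounded01 f -> bounded01 g -> bounded01 (fun t => f t + g t).
Proof.
move=> [B fB] [C gC]; exists (B + C) => t t01.
by apply: le_trans (ler_normD _ _) _; rewrite lerD ?fB ?gC.
Qed.

Lemma bounded01M f g :
  bounded01 f -> bounded01 g -> bounded01 (fun t => f t * g t).
Proof.
by move=> [B fB] [C gC]; exists (B * C) => t t01; rewrite normrM ler_pM ?fB ?gC.
Qed.

Lemma bounded01N f : bounded01 f -> bounded01 (fun t => - f t).
Proof. by move=> [B fB]; exists B => t t01; rewrite normrN fB. Qed.

Lemma bounded01X f k : bounded01 f -> bounded01 (fun t => f t ^+ k).
Proof.
move=> [B fB]; exists (B ^+ k) => t t01.
by rewrite normrX lerXn2r ?nnegrE ?fB// (le_trans _ (fB _ t01)).
Qed.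

Lemma eq0_of_bounded01 (c : R) (W : R -> R) (k : nat) : bounded01 W ->
  (forall t, 0 <= t <= 1 -> c * t ^+ k = t ^+ k.+1 * W t) -> c = 0.
Proof.
move=> [B WB] cW; apply/eqP/negPn/negP => c0.
have B0 : 0 <= B by apply: le_trans (WB 0 _) => //; rewrite lexx ler01.
have nc0 : 0 < `|c| by rewrite normr_gt0.
have D0 : 0 < B + `|c| by rewrite ltr_wpDl.
(* This [t] lies in ]0, 1] and satisfies t B < |c|, also when B = 0; dividing the relation by t^k
   gives |c| <= t B, a contradiction. *)
pose t := `|c| / (B + `|c|).
have t0 : 0 < t by rewrite divr_gt0.
have t01 : 0 <= t <= 1 by rewrite ltW//= ler_pdivrMr// mul1r lerDr.
have /eqP := cW t t01; rewrite exprSr -mulrA mulrC.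
rewrite (inj_eq (mulfI (expf_neq0 k (lt0r_neq0 t0)))) => /eqP cE.
have : `|c| <= t * B by rewrite {1}cE normrM (gtr0_norm t0) ler_wpM2l ?WB// ltW.
rewrite leNgt => /negP; apply.
by rewrite /t mulrAC ltr_pdivrMr// ltr_pM2l// ltrDl.
Qed.

(* Here [1 - d / 2 t^2 + d^2 / 24 t^4] is the Taylor polynomial of
   [cos (sqrt d * t)]; [m] is read off the coefficient of [t^4]. *)
Lemma taylor4_coef (x y z : R -> R) (d m q K : R) :
  (forall t, 0 <= t <= 1 -> x t ^+ 2 + y t ^+ 2 = z t ^+ 2) ->
  (forall t, 0 <= t <= 1 ->
    `|x t - (1 - d / 2 * t ^+ 2 + m / 24 * t ^+ 4)| <= K * t ^+ 5) ->
  (forall t, 0 <= t <= 1 -> `|y t - q * t ^+ 3| <= K * t ^+ 5) ->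
  (forall t, 0 <= t <= 1 ->
    `|z t - (1 - d / 2 * t ^+ 2 + d ^+ 2 / 24 * t ^+ 4)| <= K * t ^+ 5) ->
  m = d ^+ 2.
Proof.
move=> xyz xP yP zP.
(* Each estimate becomes an exact equality with a bounded remainder. At t = 0 the quotient is 0 by
   the convention on inverses, and the estimate itself forces f 0 = g 0. *)
have rem (f g : R -> R) :
    (forall t, 0 <= t <= 1 -> `|f t - g t| <= K * t ^+ 5) ->
    exists2 r, bounded01 r & forall t, 0 <= t <= 1 -> f t = g t + t ^+ 5 * r t.
  move=> fg; exists (fun t => (f t - g t) / t ^+ 5).
    exists `|K| => t t01; have [->|tn0] := eqVneq t 0.
      by rewrite expr0n invr0 mulr0 normr0.
    have t0 : 0 < t by rewrite lt_neqAle eq_sym tn0; case/andP: t01.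
    rewrite normrM normfV (ger0_norm (exprn_ge0 _ (ltW t0))).
    rewrite ler_pdivrMr ?exprn_gt0//; apply: le_trans (fg t t01) _.
    by rewrite ler_wpM2r ?exprn_ge0 ?ler_norm// ltW.
  move=> t t01; have [t0|tn0] := eqVneq t 0.
    have := fg t t01; rewrite t0 expr0n/= !mulr0 mul0r addr0.
    by rewrite normr_le0 subr_eq0 => /eqP.
  by rewrite mulrCA mulfV ?expf_neq0// mulr1 addrC subrK.
have [r br xr] := rem _ _ xP.
have [s bs ys] := rem _ _ yP.
have [u bu zu] := rem _ _ zP.
(* This is the coefficient of t^4 in x^2 + y^2 - z^2: x^2 contributes d^2/4 + m/12, z^2 contributes
   d^2/4 + d^2/12, and y^2 only starts at t^6. *)
have/eqP : (m - d ^+ 2) / 12 = 0; last first.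
  by rewrite mulf_eq0 invr_eq0 pnatr_eq0 orbF subr_eq0 => /eqP.
pose P t := 1 - d / 2 * t ^+ 2 + m / 24 * t ^+ 4.
pose C t := 1 - d / 2 * t ^+ 2 + d ^+ 2 / 24 * t ^+ 4.
(* The witness is minus what is left of x^2 + y^2 - z^2 after removing the t^4 term and dividing by
   t^5; its last summand comes from P^2 - C^2 = (P - C)(P + C). *)
apply: (@eq0_of_bounded01 _ (fun t => - (2 * P t * r t + t ^+ 5 * r t ^+ 2
  + q ^+ 2 * t + 2 * q * t ^+ 3 * s t + t ^+ 5 * s t ^+ 2 - 2 * C t * u t - t ^+ 5 * u t ^+ 2
  + (m - d ^+ 2) / 24 * (- d * t + (m + d ^+ 2) / 24 * t ^+ 3))) 4).
  rewrite /P /C.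
  repeat first [exact: bounded01_cst | exact: bounded01_id | assumption
    | apply: bounded01X | apply: bounded01D | apply: bounded01N
    | apply: bounded01M].
move=> t t01; have := xyz t t01; rewrite xr// ys// zu// /P /C => /eqP.
rewrite -subr_eq0 => /eqP E.
apply/eqP; rewrite -subr_eq0 -[X in _ == X]E; apply/eqP.
by field.
Qed.

End taylor.

(** * The return amplitude of a hermitian matrix *)

Section hermitian_walk.
Variable R : realType.

Lemma Re_mulrC (z : R[i]) (x : R) : Re (z * x%:C%C) = Re z * x.
Proof. by case: z => a b; rewrite /= mulr0 subr0. Qed.

Lemma Im_mulrC (z : R[i]) (x : R) : Im (z * x%:C%C) = Im z * x.
Proof. by case: z => a b; rewrite /= mulr0 add0r. Qed.

Variables (n : nat) (A : 'M[R[i]]_n) (v : 'I_n) (d : nat).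

Definition amplitude (t : R) : R[i] :=
  expmx ((- 'i%C * t%:C%C) *: A) v v.

Definition moment k : R[i] := (A ^+ k) v v.

Definition amplitude_coef k : R[i] := (k`!%:R)^-1 * ((- 'i%C) ^+ k * moment k).

Lemma exprZ_mx (c : R[i]) k : (c *: A) ^+ k = c ^+ k *: A ^+ k.
Proof.
elim: k => [|k IH]; first by rewrite !expr0 scale1r.
by rewrite !exprS IH -!mulmxE -scalemxAl -scalemxAr scalerA.
Qed.

Lemma amplitude_cvg t :
  series (fun k => Re (amplitude_coef k) * t ^+ k) @ \oo
    --> Re (amplitude t) /\
  series (fun k => Im (amplitude_coef k) * t ^+ k) @ \oo
    --> Im (amplitude t).
Proof.
have := expmx_entry_cvg ((- 'i%C * t%:C%C) *: A) v v.
rewrite -/(amplitude t).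
have E k : (k`!%:R)^-1 * (((- 'i%C * t%:C%C) *: A) ^+ k) v v =
    amplitude_coef k * (t ^+ k)%:C%C.
  by rewrite exprZ_mx mxE exprMn rmorphXn/= /amplitude_coef /moment; ring.
rewrite (_ : (fun k => Re _) =
    (fun k => Re (amplitude_coef k) * t ^+ k)); last first.
  by apply/funext => k; rewrite -Re_mulrC -E.
rewrite (_ : (fun k => Im _) =
    (fun k => Im (amplitude_coef k) * t ^+ k)); last first.
  by apply/funext => k; rewrite -Im_mulrC -E.
by [].
Qed.

Lemma normc_amplitude_coef_le k :
  `|amplitude_coef k| <= (exp_coeff (mx_sum_norm A) k)%:C%C.
Proof.
rewrite !normrM normrX normrN normfV normr_nat.
have -> : `|'i%C : R[i]| = 1.
  by rewrite normc_def/= expr0n expr1n add0r sqrtr1.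
rewrite expr1n mul1r /exp_coeff/= mulrC rmorphM/= fmorphV/= rmorph_nat.
by rewrite ler_wpM2r ?invr_ge0 ?ler0n// norm_expr_mx_le.
Qed.

Lemma amplitude_taylor t : 0 <= t <= 1 ->
  `|Re (amplitude t) - \sum_(k < 5) Re (amplitude_coef k) * t ^+ k|
    <= expR (mx_sum_norm A) * t ^+ 5 /\
  `|Im (amplitude t) - \sum_(k < 5) Im (amplitude_coef k) * t ^+ k|
    <= expR (mx_sum_norm A) * t ^+ 5.
Proof.
move=> t01; have [cR cI] := amplitude_cvg t.
split; [apply: series_taylor_tail cR|apply: series_taylor_tail cI] => // k.
  by rewrite -lecR; exact: le_trans (normc_ge_Re _) (normc_amplitude_coef_le k).
by rewrite -lecR; exact: le_trans (normc_ge_Im _) (normc_amplitude_coef_le k).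
Qed.

Hypothesis A_herm : forall i j, A i j = (A j i)^*.

Lemma expr_herm k i j : (A ^+ k) i j = ((A ^+ k) j i)^*.
Proof.
elim: k i j => [|k IH] i j.
  by rewrite expr0 !mxE eq_sym; case: (j == i); rewrite ?rmorph1 ?rmorph0.
rewrite {1}exprSr exprS !mxE rmorph_sum; apply: eq_bigr => l _.
by rewrite rmorphM/= -IH -A_herm mulrC.
Qed.

(** The moments of a hermitian matrix are real, so even moments only enter the real part of the
    amplitude and odd ones only the imaginary part. *)
Lemma amplitude_coefE k :
  amplitude_coef k = (- 'i%C) ^+ k * ((k`!%:R)^-1 * Re (moment k))%:C%C.
Proof.
have -> : amplitude_coef k =
    (k`!%:R)^-1 * ((- 'i%C) ^+ k * (Re (moment k))%:C%C).
  by rewrite /amplitude_coef RRe_real// CrealE -expr_herm.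
by rewrite rmorphM/= fmorphV/= rmorph_nat mulrCA.
Qed.

Lemma Re_amplitude_sum t :
  \sum_(k < 5) Re (amplitude_coef k) * t ^+ k =
  Re (moment 0) - Re (moment 2) / 2 * t ^+ 2 + Re (moment 4) / 24 * t ^+ 4.
Proof.
have i2 : (- 'i%C) ^+ 2 = -1 :> R[i] by rewrite sqrrN sqr_i.
rewrite !big_ord_recr big_ord0/= !amplitude_coefE !Re_mulrC.
rewrite (exprD _ 2 2) (exprD _ 2 1) i2 !expr0 !expr1 mulrNN mulr1 mulN1r opprK.
by rewrite !factS fact0/=; field.
Qed.

Lemma Im_amplitude_sum t : Re (moment 1) = 0 ->
  \sum_(k < 5) Im (amplitude_coef k) * t ^+ k = Re (moment 3) / 6 * t ^+ 3.
Proof.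
move=> m1; have i2 : (- 'i%C) ^+ 2 = -1 :> R[i] by rewrite sqrrN sqr_i.
rewrite !big_ord_recr big_ord0/= !amplitude_coefE !Im_mulrC m1.
rewrite (exprD _ 2 2) (exprD _ 2 1) i2 !expr0 !expr1 mulrNN mulr1 mulN1r opprK.
by rewrite !factS fact0/=; field.
Qed.

Lemma moment4 : moment 4 = \sum_w `|(A ^+ 2) w v| ^+ 2.
Proof.
rewrite /moment (exprD A 2 2) mxE; apply: eq_bigr => w _.
by rewrite expr_herm mulrC normCK.
Qed.

Hypothesis Avv : A v v = 0.
Hypothesis A2vv : (A ^+ 2) v v = d%:R.

Lemma walk_moment4 :
  (forall t, 0 <= t ->
    `|amplitude t| ^+ 2 = ((cos (Num.sqrt d%:R * t)) ^+ 2)%:C%C) ->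
  moment 4 = d%:R ^+ 2.
Proof.
move=> walk.
(* One constant must serve for the remainders of both the amplitude and the cosine. *)
pose K := Num.max (expR (mx_sum_norm A)) (expR (Num.sqrt d%:R)).
have maxK (x t : R) b : 0 <= t <= 1 -> x <= expR b * t ^+ 5 ->
    expR b <= K -> x <= K * t ^+ 5.
  move=> /andP[t0 _] /le_trans xb bK; apply: xb.
  by rewrite ler_wpM2r// exprn_ge0.
have m0 : moment 0 = 1 by rewrite /moment expr0 mxE eqxx.
have ReC1 : Re (1 : R[i]) = 1 by [].
have A2m : Re (moment 2) = d%:R.
  by rewrite /moment A2vv -(rmorph_nat (real_complex R)).
have m1 : moment 1 = 0 by rewrite /moment expr1.
have sd : Num.sqrt d%:R ^+ 2 = d%:R :> R by rewrite sqr_sqrtr.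
have -> : moment 4 = (Re (moment 4))%:C%C.
  by rewrite RRe_real// CrealE -expr_herm.
rewrite (@taylor4_coef R (fun t => Re (amplitude t)) (fun t => Im (amplitude t))
    (fun t => cos (Num.sqrt d%:R * t)) d%:R (Re (moment 4))
    (Re (moment 3) / 6) K).
- by rewrite rmorphXn/= rmorph_nat.
- move=> t /andP[t0 _]; apply: complexI; rewrite -walk//.
  exact: add_Re2_Im2.
- move=> t t01; have [+ _] := amplitude_taylor t01.
  rewrite Re_amplitude_sum m0 A2m ReC1 => /(maxK _ _ _ t01); apply.
  by rewrite le_max lexx.
- move=> t t01; have [_ +] := amplitude_taylor t01.
  rewrite Im_amplitude_sum ?m1// => /(maxK _ _ _ t01); apply.
  by rewrite le_max lexx.
- move=> t t01.
  (* [cos_coeff] is homogeneous of degree [k] in its argument, so the cosine is a power series in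
     [t] with coefficients dominated by those of exp at sqrt d, and the same tail estimate
     applies. *)
  have cosE : cos (Num.sqrt d%:R * t) =
      limn (series (fun k => cos_coeff (Num.sqrt d%:R) k * t ^+ k)) :> R.
    rewrite unlock; congr (limn (series _)); apply/funext => k.
    by rewrite /cos_coeff/= exprMn; ring.
  apply: (maxK _ _ (Num.sqrt d%:R) t01); last by rewrite /K le_max lexx orbT.
  have -> : 1 - d%:R / 2 * t ^+ 2 + d%:R ^+ 2 / 24 * t ^+ 4 =
      \sum_(k < 5) cos_coeff (Num.sqrt d%:R) k * t ^+ k :> R.
    rewrite !big_ord_recr big_ord0/= /cos_coeff/= !factS fact0/= -!exprnP.
    by move: (Num.sqrt d%:R) sd => s <-; field.
  apply: series_taylor_tail t01 _ => [k|].
    rewrite /cos_coeff /exp_coeff/= -mulrA normrM -[leRHS]mul1r ler_pM//.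
      rewrite -exprnP normrM normrX normrN1 expr1n mulr1.
      by case: (odd k); rewrite ?normr0 ?normr1.
    by rewrite ger0_norm// divr_ge0// exprn_ge0// sqrtr_ge0.
  have := @is_cvg_series_cos_coeff R (Num.sqrt d%:R * t).
  rewrite [X in series X](_ : _ =
    (fun k => cos_coeff (Num.sqrt d%:R) k * t ^+ k)) -?cosE//.
  by apply/funext => k; rewrite /cos_coeff/= exprMn; ring.
Qed.

Lemma walk_of_eigen : (forall w, w != v -> (A ^+ 2) w v = 0) ->
  forall t, amplitude t = (cos (Num.sqrt d%:R * t))%:C%C.
Proof.
move=> A2.
have mE k : forall w, (A ^+ k.*2) w v = d%:R ^+ k * (w == v)%:R.
  elim: k => [|k IH] w; first by rewrite expr0 mxE mul1r.
  rewrite doubleS -addn2 exprD mxE (bigD1 v)//= big1 => [|l lv].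
    by rewrite IH A2vv exprSr addr0 mulrAC.
  by rewrite A2// mulr0.
have mO k : moment k.*2.+1 = 0.
  rewrite /moment exprS mxE big1// => l _; rewrite mE.
  by have [->|_] := eqVneq l v; rewrite ?Avv ?mul0r ?mulr0.
have sd : Num.sqrt d%:R ^+ 2 = d%:R :> R by rewrite sqr_sqrtr.
have cE k t : amplitude_coef k * (t ^+ k)%:C%C =
    (cos_coeff (Num.sqrt d%:R * t) k)%:C%C.
  (* Odd terms vanish on both sides; for k = 2m both are (-1)^m d^m t^(2m) / (2m)!. *)
  rewrite -(odd_double_half k); move: (odd k) k./2 => [] m {k}.
    by rewrite /amplitude_coef /cos_coeff/= mO odd_double !mulr0 !mul0r.
  rewrite /amplitude_coef /cos_coeff/= add0n odd_double doubleK -exprnP.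
  rewrite /moment mE eqxx mulr1 mul1r -mul2n !exprM sqrrN sqr_i.
  rewrite (_ : (Num.sqrt d%:R * t) ^+ 2 = d%:R * t ^+ 2); last first.
    by rewrite exprMn sd.
  rewrite [(d%:R * _) ^+ m]exprMn.
  rewrite !rmorphM/= fmorphV/= !rmorphXn/= rmorphN1 !rmorph_nat.
  by ring.
move=> t; have [cR cI] := amplitude_cvg t.
apply/eqP; rewrite eq_complex/=; apply/andP; split.
  rewrite -(cvg_lim (@Rhausdorff R) cR) [in X in _ == X]unlock.
  apply/eqP; congr (limn (series _)); apply/funext => k.
  by rewrite -Re_mulrC cE.
rewrite -(cvg_lim (@Rhausdorff R) cI) (_ : (fun k => _) = (fun=> 0)).
  by apply/eqP/lim_near_cst => //; near=> N; rewrite seriesEnat/= big1.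
by apply/funext => k; rewrite -Im_mulrC cE.
Unshelve. all: by end_near. Qed.

(** In coordinates, the equality case of Cauchy-Schwarz reads: the fourth moment is a sum of squares
    whose term at [v] is already d^2, so all other terms vanish. *)
Lemma hermitian_walkP :
  (forall t, 0 <= t ->
    `|amplitude t| ^+ 2 = ((cos (Num.sqrt d%:R * t)) ^+ 2)%:C%C) <->
  (forall w, w != v -> (A ^+ 2) w v = 0).
Proof.
split=> [/walk_moment4|/walk_of_eigen ampE t _]; last first.
  by rewrite ampE normc_real -rmorphXn/= real_normK ?num_real.
rewrite moment4 (bigD1 v)//= A2vv normr_nat => /eqP.
rewrite -[eqbRHS]addr0 (inj_eq (addrI _)) => /eqP/psumr_eq0P A2 w wv.
by apply/normr0_eq0/eqP; rewrite -sqrf_eq0 A2// => *; exact: exprn_ge0.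
Qed.

End hermitian_walk.

(** * Chiral weights on a graph and on its cone *)

Section chiral_weights.
Variable R : realType.

(** Indexing by vertices instead of ordinals lets weights pass between the graph and its cone
    without relating their two enumerations. *)
Definition chiral_weights (T : finType) (e : rel T) (a : T -> T -> R[i]) :=
  [/\ forall x y, a x y = (a y x)^*, forall x y, e x y -> `|a x y| = 1 &
      forall x y, ~~ e x y -> a x y = 0].

Lemma swift_walkP (T : finType) (e : rel T) (v : T) : ~~ e v v ->
  swift_walk R e v <->
  exists2 a, chiral_weights e a &
    forall w, w != v -> \sum_u a w u * a u v = 0.
Proof.
move=> evv.
have ketE (E : 'M[R[i]]_#|T|) :
    ((ket R v)^t* *m E *m ket R v) 0 0 = E (enum_rank v) (enum_rank v).
  by rewrite /ket trmx_delta map_delta_mx -rowE -colE !mxE.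
(* Relating [A] to [a] only through [enum_rank] makes this usable both for weights read off a matrix
   and for a matrix built from weights. *)
have main (A : 'M[R[i]]_#|T|) (a : T -> T -> R[i]) :
    (forall x y, A (enum_rank x) (enum_rank y) = a x y) ->
    chiral_weights e a ->
    (forall t : R, 0 <= t ->
      `|((ket R v) ^t* *m expmx ((- 'i%C * t%:C%C) *: A) *m ket R v) 0 0| ^+ 2
      = ((cos (Num.sqrt (degree e v)%:R * t)) ^+ 2)%:C%C) <->
    (forall w, w != v -> \sum_u a w u * a u v = 0).
  move=> Aa [a_herm a1 a0].
  have A2E x y : (A ^+ 2) (enum_rank x) (enum_rank y) = \sum_u a x u * a u y.
    rewrite expr2 mxE (reindex _ (onW_bij _ (@enum_rank_bij T)))/=.
    by apply: eq_bigr => u _; rewrite !Aa.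
  have A_herm i j : A i j = (A j i)^*.
    by rewrite -(enum_valK i) -(enum_valK j) !Aa.
  have Avv : A (enum_rank v) (enum_rank v) = 0 by rewrite Aa a0.
  (* By hermitian symmetry each term is |a v u|^2, that is 1 on the neighbours of [v] and 0
     elsewhere. *)
  have A2vv : (A ^+ 2) (enum_rank v) (enum_rank v) = (degree e v)%:R.
    rewrite A2E /degree -sum1_card natr_sum [RHS]big_mkcond/=.
    apply: eq_bigr => u _; rewrite [a u v]a_herm -normCK inE.
    by case: ifPn => [/a1->|/a0->]; rewrite ?expr1n// normr0 expr0n.
  have [walk eig] := hermitian_walkP A_herm Avv A2vv.
  split=> [H w wv|H t t0].
    rewrite -A2E walk// => [t t0|]; first by rewrite -H// ketE.
    by rewrite (inj_eq enum_rank_inj).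
  rewrite ketE; apply: eig => // w wv.
  rewrite -(enum_valK w) A2E H//.
  by apply: contraNneq wv => <-; rewrite enum_valK.
have adjE x y : adjmx R[i] e (enum_rank x) (enum_rank y) = (e x y)%:R.
  by rewrite mxE !enum_rankK.
split=> [[A [[/is_hermitianmxP A_herm A1 A0] walk]]|[a ach a2]].
  have Ach : chiral_weights e (fun x y => A (enum_rank x) (enum_rank y)).
    split=> [x y|x y exy|x y nexy].
    - by rewrite {1}A_herm expr0 scale1r !mxE.
    - by apply: A1; rewrite adjE exy.
    - by apply: A0; rewrite adjE (negbTE nexy).
  by exists (fun x y => A (enum_rank x) (enum_rank y)) => //; apply/(main A).
exists (\matrix_(i, j) a (enum_val i) (enum_val j)); split; last first.
  by apply/main/a2 => // x y; rewrite mxE !enum_rankK.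
case: ach => a_herm a1 a0; split.
- apply/is_hermitianmxP; rewrite expr0 scale1r; apply/matrixP => i j.
  by rewrite !mxE.
- move=> j k; rewrite !mxE => /eqP.
  by have [/a1|_] := boolP (e _ _); rewrite // eq_sym oner_eq0.
- move=> j k; rewrite !mxE => /eqP.
  by have [_|/a0] := boolP (e _ _); rewrite // oner_eq0.
Qed.

End chiral_weights.

(** The polynomial 1 + X + ... + X^(m-1) is not constant, so it has a root in the closed field
    [R[i]]. Multiplying by X - 1 shows that this root satisfies z^m = 1, hence has modulus 1. *)
Lemma unit_complex_sum0 (R : realType) (m : nat) : (1 < m)%N ->
  exists2 z : R[i], `|z| = 1 & \sum_(i < m) z ^+ i = 0.
Proof.
move=> m1.
have /closed_rootP[z] : size (\poly_(i < m) (1 : R[i])) != 1%N.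
  rewrite size_poly_eq ?oner_eq0//.
  by rewrite neq_ltn m1 orbT.
rewrite rootE horner_poly => /eqP z0; exists z; last first.
  by rewrite -[RHS]z0; apply: eq_bigr => i _; rewrite mul1r.
have : z ^+ m = 1.
  apply/eqP; rewrite -subr_eq0 subrX1 -[X in _ * X](_ : 0 = _) ?mulr0//.
  by rewrite -[LHS]z0; apply: eq_bigr => i _; rewrite mul1r.
move=> /(congr1 Num.norm); rewrite normrX normr1 => /eqP.
by rewrite pexpr_eq1// ?(ltnW m1)// => /eqP.
Qed.

Lemma unit_weights_sum0 (R : realType) (T : finType) (C : {set T}) :
  #|C| != 1%N ->
  exists2 c : T -> R[i], forall u, `|c u| = 1 & \sum_(u in C) c u = 0.
Proof.
move=> C1; have [C0|C0] := posnP #|C|.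
  exists (fun=> 1) => [_|]; first exact: normr1.
  by rewrite big_pred0// => u; rewrite (cards0_eq C0) inE.
have /(unit_complex_sum0 R)[z z1 zs] : (1 < #|C|)%N.
  by rewrite ltn_neqAle eq_sym C1.
(* On [C] the index runs once through 0, ..., #|C| - 1; off [C] it is #|C|, which still yields a
   number of modulus 1. *)
exists (fun u => z ^+ index u (enum C)) => [u|].
  by rewrite normrX z1 expr1n.
case/card_gt0P: (C0) => x0 _.
rewrite -big_enum/= (big_nth x0) big_mkord -cardE -[RHS]zs.
apply: eq_bigr => i _; rewrite index_uniq ?enum_uniq// -cardE.
exact: ltn_ord.
Qed.

(** * Restriction of weights to the cone and extension from it *)

Section cone_walk.
Variables (R : realType) (T : finType) (e : rel T) (v : T).
Hypotheses (e_sym : symmetric e) (e_irr : irreflexive e).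

Let S := closed_nbrs e v.
Let C w := nbrs e w :&: nbrs e v.

Let adj_closed u : e u v -> u \in S.
Proof. by rewrite e_sym !inE orbC => ->. Qed.

(** The factor a u v vanishes unless [u] is a neighbour of [v], so the equation at a vertex of the
    cone stays inside the cone. *)
Let sum_closed (a : T -> T -> R[i]) w :
  (forall x y, ~~ e x y -> a x y = 0) ->
  \sum_u a w u * a u v = \sum_(u in S) a w u * a u v.
Proof.
move=> a0; rewrite [RHS]big_mkcond; apply: eq_bigr => u _.
case: ifPn => // uS; rewrite [a u v]a0 ?mulr0//.
by apply: contra uS; exact: adj_closed.
Qed.

Lemma swift_walk_cone : swift_walk R e v -> swift_walk R (cone e v) (apex e v).
Proof.
case/swift_walkP => [|a [a_herm a1 a0] a2]; first by rewrite e_irr.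
apply/swift_walkP; first exact: negbT (e_irr v).
exists (fun x y => a (val x) (val y)).
  by split=> x y; [exact: a_herm|exact: a1|exact: a0].
move=> w wv; rewrite -[RHS](a2 (val w)); last first.
  by apply: contraNneq wv => wv; apply/eqP/val_inj.
by rewrite sum_closed// [RHS]big_sub.
Qed.

(** With a single common neighbour the sum at [w] would reduce to one product of modulus 1, which is
    not 0. *)
Lemma swift_walk_common_nbrs : swift_walk R e v ->
  forall w, w != v -> w \notin nbrs e v -> #|C w| != 1%N.
Proof.
case/swift_walkP => [|a [a_herm a1 a0] a2]; first by rewrite e_irr.
move=> w wv wN; apply/negP => /cards1P[u Cu].
have /setIP[] : u \in C w by rewrite Cu set11.
rewrite !inE => ewu evu; have /eqP := a2 w wv.
rewrite (bigD1 u)//= big1 => [|x xu].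
  by rewrite addr0 -normr_eq0 normrM !a1 ?mulr1 ?oner_eq0// e_sym.
have [ewx|/a0->] := boolP (e w x); last by rewrite mul0r.
rewrite [a x v]a0 ?mulr0//; apply: contra xu => exv.
have : x \in C w by rewrite !inE ewx e_sym.
by rewrite Cu inE.
Qed.

(** The given weights are kept on the cone. The equations at distinct outside vertices involve
    disjoint sets of edges leaving the cone, so the phases can be chosen for each such vertex
    separately. *)
Lemma swift_walk_extend : swift_walk R (cone e v) (apex e v) ->
  (forall w, w != v -> w \notin nbrs e v -> #|C w| != 1%N) ->
  swift_walk R e v.
Proof.
case/swift_walkP => [|b [b_herm b1 b0] b2 C1].
  exact: negbT (e_irr v).
have vS : v \in S by rewrite !inE eqxx.
have /choice[c cP] w : exists c : T -> R[i], (forall u, `|c u| = 1) /\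
    (w \notin S -> \sum_(u in C w) c u = 0).
  have [wS|] := boolP (w \in S).
    by exists (fun=> 1); split=> // _; exact: normr1.
  rewrite in_setU1 negb_or => /andP[wv wN].
  by have [c c1 c0] := unit_weights_sum0 R (C1 w wv wN); exists c.
(* Outside [S], [insubd] returns the apex; [aS] is meaningful only on [S], and [a] below uses it
   only there. *)
pose aS x y := b (insubd (apex e v) x) (insubd (apex e v) y).
have aS_herm x y : aS x y = (aS y x)^* by exact: b_herm.
have valS x : x \in S -> val (insubd (apex e v) x) = x by exact: insubdK.
have coneE x y : x \in S -> y \in S ->
    cone e v (insubd (apex e v) x) (insubd (apex e v) y) = e x y.
  by move=> xS yS; rewrite -[in RHS](valS _ xS) -[in RHS](valS _ yS).
have aS1 x y : x \in S -> y \in S -> e x y -> `|aS x y| = 1.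
  by move=> xS yS exy; apply: b1; rewrite coneE.
have aS0 x y : x \in S -> y \in S -> ~~ e x y -> aS x y = 0.
  by move=> xS yS exy; apply: b0; rewrite coneE.
(* Dividing by [aS u v] turns the sum over the common neighbours of [w] and
   [v] into that of the [c w u]. *)
pose o w u := if e w u then c w u / aS u v else 0.
have o1 w u : w \notin S -> u \in S -> e w u -> `|o w u| = 1.
  move=> wS uS ewu; rewrite /o ewu normrM normfV (cP w).1 aS1 ?divr1//.
  (* Since [w] lies outside [S] it is not adjacent to [v], so [u] differs from [v] and the divisor
     has modulus 1. *)
  rewrite e_sym; move: uS; rewrite !inE => /orP[/eqP uv|//].
  by move: wS; rewrite adj_closed// -uv.
(* Between the cone and the outside, one direction carries [o] and the other its conjugate; edges
   with no end in [S] get weight 1. *)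
pose a x y := if x \in S then if y \in S then aS x y else (o y x)^*
  else if y \in S then o x y else (e x y)%:R.
have a0 x y : ~~ e x y -> a x y = 0.
  rewrite /a => nexy; case: ifPn => xS; case: ifPn => yS; first exact: aS0.
  - by rewrite /o e_sym (negbTE nexy) rmorph0.
  - by rewrite /o (negbTE nexy).
  - by rewrite (negbTE nexy).
apply/swift_walkP; first by rewrite e_irr.
exists a.
  split=> // [x y|x y exy]; rewrite /a.
    case: ifPn => xS; case: ifPn => yS //; first by rewrite conjCK.
    by rewrite e_sym rmorph_nat.
  case: ifPn => xS; case: ifPn => yS; first exact: aS1.
  - by rewrite norm_conjC o1// e_sym.
  - exact: o1.
  - by rewrite exy normr1.
move=> w wv; rewrite sum_closed//; have [wS|wS] := boolP (w \in S).
  rewrite [LHS]big_sub/= -[RHS](b2 (insubd (apex e v) w)).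
    apply: eq_bigr => u _; rewrite /a wS vS (valP u) /aS valKd.
    by congr (_ * b _ _); apply: val_inj; rewrite insubdK.
  by apply: contraNneq wv => /(congr1 val); rewrite insubdK//= => ->.
(* The two sums agree term by term: o w u * aS u v = c w u at a common neighbour [u], and both sides
   are 0 elsewhere. *)
rewrite -[RHS]((cP w).2 wS) [LHS]big_mkcond [RHS]big_mkcond/=.
apply: eq_bigr => u _; rewrite !inE; case: (boolP (e w u)) => ewu; last first.
  by rewrite /= a0 ?mul0r ?if_same.
have [evu|evu] := boolP (e v u); last first.
  by rewrite [a u v]a0 ?mulr0 ?if_same// e_sym.
have uS : u \in S by rewrite !inE evu orbT.
rewrite orbT/= /a (negbTE wS) uS vS /o ewu divfK//.
by rewrite -normr_eq0 aS1 ?oner_eq0// e_sym.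
Qed.

End cone_walk.

Theorem theorem5 (R : realType) (T : finType) (e : rel T)
    (e_sym : symmetric e) (e_irr : irreflexive e)
    (e_conn : connected_graph e) (v : T) :
  swift_walk R e v <->
  (swift_walk R (cone e v) (apex e v) /\
   (forall v' : T, v' <> v -> v' \notin nbrs e v ->
      #|nbrs e v' :&: nbrs e v| = 0%N \/
      (2 <= #|nbrs e v' :&: nbrs e v|)%N)).
Proof.
split=> [walk|[walk common]].
  split=> [|w /eqP wv wN]; first exact: swift_walk_cone.
  have := swift_walk_common_nbrs e_sym e_irr walk wv wN.
  by case: #|_| => [|[|m]] // _; [left|right].
apply: swift_walk_extend => // w /eqP wv wN.
by case: (common w wv wN) => [->|]; last by case: #|_| => [|[]].
Qed.
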